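(* Let $I_{\mathcal{L}}$ be the lattice ideal of $\mathcal{L}$. Consider the equivalence relation on $R$ given by $f\equiv f'$ if and only if $f=cf'$ for some $c\in\Bbbk^*$. Let $T$ be the set of equivalence classes of the minimal binomials of $I_{\mathcal{L}}$. Then $$|T|=\sum_{\mathbf{b}\in\mathcal{A}}\ \sum_{i<j}t_i(\mathbf{b})\,t_j(\mathbf{b}),$$ where, for each $\mathbf{b}\in\mathcal{A}$, the connected components of $\Delta_{\gcd}(\mathbf{b})$ are ordered in some fixed way, $t_i(\mathbf{b})$ is the number of vertices of the $i$-th connected component, and the inner sum runs over pairs of indices $i<j$ of components (unordered pairs of distinct components).
   Context: Let $\mathcal{L}\subset\mathbb{Z}^n$ be a lattice (subgroup) with $\mathcal{L}\cap\mathbb{N}^n=\{\mathbf{0}\}$, and let $\mathcal{A}$ be the subsemigroup (containing $0$) of $\mathbb{Z}^n/\mathcal{L}$ generated by $\mathbf{a}_i=\mathbf{e}_i+\mathcal{L}$, $1\le i\le n$, where $\mathbf e_1,\dots,\mathbf e_n$ is the canonical basis of $\mathbb{Z}^n$. Let $\Bbbk$ be a field and $R=\Bbbk[x_1,\dots,x_n]$, multigraded by $\mathcal{A}$ via $\deg_{\mathcal{A}}(\mathbf{x}^{\mathbf{v}})=v_1\mathbf{a}_1+\cdots+v_n\mathbf{a}_n$. The lattice ideal $I_{\mathcal{L}}$ is generated by all binomials $\mathbf{x}^{\mathbf{u}_+}-\mathbf{x}^{\mathbf{u}_-}$ with $\mathbf{u}_+,\mathbf{u}_-\in\mathbb{N}^n$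 and $\mathbf{u}_+-\mathbf{u}_-\in\mathcal{L}$; it is $\mathcal{A}$-homogeneous. A binomial of $I_{\mathcal{L}}$ is a nonzero constant multiple of a difference $\mathbf{x}^{\mathbf{u}}-\mathbf{x}^{\mathbf{v}}\in I_{\mathcal L}$ of two distinct monomials. It is minimal if it is part of a minimal $\mathcal{A}$-homogeneous generating set of $I_{\mathcal{L}}$. For $\mathbf{b}\in\mathcal{A}$ the fiber is the (finite) set of monomials $C_{\mathbf{b}}=\{\mathbf{x}^{\mathbf{u}}:\deg_{\mathcal{A}}(\mathbf{x}^{\mathbf{u}})=\mathbf{b}\}$. The gcd-complex $\Delta_{\gcd}(\mathbf{b})$ is the simplicial complex on vertex set $C_{\mathbf{b}}$ whose faces are the empty set and all nonempty subsets $T'\subset C_{\mathbf{b}}$ with $\gcd(\mathbf{x}^{\mathbf{a}}:\mathbf{x}^{\mathbf{a}}\in T')\ne1$. Its connected components partition $C_{\mathbf{b}}$: two monomials of $C_{\mathbf{b}}$ lie in the same component if and only if they are equal or joined by a sequence of monomials in $C_{\mathbf{b}}$ in which consecutive ones have gcd $\ne1$. *)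

(* Defs.v *)
From Stdlib Require Import Relation_Operators.
From mathcomp Require Import all_boot all_order all_algebra.
From mathcomp Require Import generic_quotient ring_quotient.
From mathcomp Require Import finmap boolp classical_sets functions cardinality fsbigop.
From mathcomp Require Import mpoly.

Set Implicit Arguments.
Unset Strict Implicit.
Unset Printing Implicit Defensive.

Import GRing.Theory.

Local Open Scope classical_set_scope.
Local Open Scope ring_scope.

Section Ideals.
Variable R : comNzRingType.

Definition is_ideal (I : set R) : Prop :=
  [/\ I 0, forall f g, I f -> I g -> I (f + g)
    & forall r f, I f -> I (r * f)].

Definition ideal_generated (S : set R) : set R := smallest is_ideal S.

End Ideals.

Section Grading.
Variables (n : nat) (L : zmodClosed 'rV[int]_n).

Definition agen (i : 'I_n) : Quotient.quot L := \pi_(Quotient.quot L)%qT (delta_mx 0 i).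

Definition is_submonoid (B : set (Quotient.quot L)) : Prop :=
  B 0 /\ forall a b, B a -> B b -> B (a + b).

Definition monoidA : set (Quotient.quot L) := smallest is_submonoid (range agen).

Definition degA (u : 'X_{1..n}) : Quotient.quot L := \sum_(i < n) agen i *+ u i.

Definition fiber (b : Quotient.quot L) : set 'X_{1..n} := [set u | degA u = b].

End Grading.

Arguments monoidA {n} L b.
Arguments degA {n} L u.

Section GcdComplex.
Variable n : nat.

(* The unit of the minimum is an upper bound of the exponents, so that it is
   neutral as soon as [F] is nonempty; [mgcd fset0] is the monomial 1. *)
Definition mgcd (F : {fset 'X_{1..n}}) : 'X_{1..n} :=
  [multinom \big[minn/(\max_(u <- F) u i)%N]_(u <- F) u i | i < n].

Variable L : zmodClosed 'rV[int]_n.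

Definition gcd_complex (b : Quotient.quot L) : set {fset 'X_{1..n}} :=
  [set F | F = fset0 \/
    [/\ F != fset0, [set` F] `<=` fiber b & mgcd F != 0%MM]].

(* Reflexivity is needed for the monomial 1: it is a vertex of the complex
   of the degree 0, but its singleton is not a face. *)
Definition connected_in (D : set {fset 'X_{1..n}}) (u v : 'X_{1..n}) : Prop :=
  clos_refl_trans _ (fun u' v' => D [fset u'; v']%fset) u v.

Definition components (b : Quotient.quot L) : set (set 'X_{1..n}) :=
  [set [set v | fiber b v /\ connected_in (gcd_complex b) u v]
     | u in fiber b].

Definition nvertices (K : set 'X_{1..n}) : nat := #|` fset_set K|.

(* The components are ordered by the enumeration of the finite set they form. *)
Definition component_pairs (b : Quotient.quot L) : nat :=
  let K := enum_fset (fset_set (components b)) in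
  let t i := nvertices (nth set0 K i) in
  (\sum_(i < size K) \sum_(j < size K | i < j) t i * t j)%N.

End GcdComplex.

Section LatticeIdeal.
Variables (n : nat) (k : fieldType) (L : zmodClosed 'rV[int]_n).
Local Notation R := {mpoly k[n]}.

Definition expvec (u : 'X_{1..n}) : 'rV[int]_n := \row_i (u i)%:Z.

Definition lattice_ideal : set R :=
  ideal_generated [set f | exists u v : 'X_{1..n},
    expvec u - expvec v \in L /\ f = 'X_[u] - 'X_[v]].

Definition homogeneousA (f : R) : Prop :=
  exists2 b, monoidA L b & forall u, u \in msupp f -> degA L u = b.

Definition homogeneous_generating_set (S : set R) : Prop :=
  S `<=` homogeneousA /\ ideal_generated S = lattice_ideal.

Definition minimal_generating_set (S : set R) : Prop :=
  homogeneous_generating_set S /\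
  forall S' : set R, S' `<=` S -> homogeneous_generating_set S' -> S' = S.

Definition binomial (f : R) : Prop :=
  exists (c : k) (u v : 'X_{1..n}),
    [/\ c != 0, u != v, lattice_ideal ('X_[u] - 'X_[v])
      & f = c *: ('X_[u] - 'X_[v])].

Definition minimal_binomial (f : R) : Prop :=
  binomial f /\ exists2 S, minimal_generating_set S & S f.

Definition scalar_equiv (f f' : R) : Prop := exists2 c : k, c != 0 & f = c *: f'.

Definition minimal_binomial_classes : set (set R) :=
  [set [set g | scalar_equiv g f] | f in minimal_binomial].

End LatticeIdeal.

Arguments minimal_binomial_classes {n} k L _.

(* Main.v *)
Require Import Defs.
From HB Require Import structures.
From Stdlib Require Import Relation_Operators.
From mathcomp Require Import all_boot all_order all_algebra.
From mathcomp Require Import generic_quotient ring_quotient.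
From mathcomp Require Import finmap boolp classical_sets functions cardinality fsbigop.
From mathcomp Require Import mpoly ring.

(** Call two monomials of the same degree linked when they lie in the same
    component of the gcd-complex. A binomial [c (x^u - x^v)] of the lattice
    ideal is minimal iff [u] and [v] are not linked.

    If [u] and [v] are linked, then [x^u - x^v] is a sum of elements
    [x_i (x^p - x^q)] with [x^p - x^q] in the ideal and of a degree whose fiber
    has smaller maximal total degree, hence generated by the other elements of
    any homogeneous generating set. Conversely, the binomials joining a base
    monomial of each fiber to representatives of the other components generate
    the ideal, and the sum of the coefficients over one component is a linear
    functional that vanishes on all their monomial multiples but one; the base
    and the representatives can be chosen so that [u] and [v] are joined.

    Pairs of monomials that are not linked are minimal for the componentwise
    order, so Dickson's lemma leaves finitely many of them; orienting each pair
    by the ranks of its components gives the count. *)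

Set Implicit Arguments.
Unset Strict Implicit.
Unset Printing Implicit Defensive.

Import GRing.Theory Num.Theory.

Local Open Scope classical_set_scope.
Local Open Scope ring_scope.

(** * Dickson's lemma, by extraction of monotone subsequences *)

Lemma nat_nondecreasing_subseq (f : nat -> nat) :
  exists g : nat -> nat, {homo g : i j / (i < j)%N} /\
    {homo f \o g : i j / (i <= j)%N}.
Proof.
(* Past every index [N], some value of [f] is least among all those past [N]; jumping repeatedly to
   such an index gives the subsequence. *)
have minf N : exists m, (N <= m)%N /\ forall j, (N <= j)%N -> (f m <= f j)%N.
  have ex : exists y, `[< exists2 m, (N <= m)%N & f m = y >].
    by exists (f N); apply/asboolP; exists N.
  case: (ex_minnP ex) => y /asboolP[m Nm <-] ymin; exists m; split=> // j Nj.
  by apply: ymin; apply/asboolP; exists j.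
have /choice[c cP] := minf.
pose g := fix g i := if i is j.+1 then c (g j).+1 else c 0%N.
have gS i : (g i < g i.+1)%N by have [] := cP (g i).+1.
exists g; split; first by apply: homo_ltn => //; exact: ltn_trans.
apply: homo_leq => [//||i]; first exact: leq_trans.
rewrite /=; case: i => [|i] /=; first by apply: (cP 0%N).2.
by apply: (cP (g i).+1).2; apply: leq_trans (ltnW (gS i.+1)).
Qed.

Lemma dickson_subseq (I : eqType) (r : seq I) (h : I -> nat -> nat) :
  exists g : nat -> nat, {homo g : i j / (i < j)%N} /\
    forall i, i \in r -> {homo h i \o g : a b / (a <= b)%N}.
Proof.
elim: r => [|i r [g [g_lt g_le]]]; first by exists id; split.
have [g' [g'_lt g'_le]] := nat_nondecreasing_subseq (h i \o g).
exists (g \o g'); split=> [a b ab|j]; first exact/g_lt/g'_lt.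
rewrite inE => /predU1P[->|/g_le gj] a b ab; first exact: g'_le.
exact: gj (ltnW_homo g'_lt ab).
Qed.

(** An infinite [A] contains an injective sequence. Along a subsequence monotone in every coordinate
    the first two terms are comparable, hence equal by hypothesis, against injectivity. *)
Lemma dickson (J : finType) (T : Type) (h : J -> T -> nat) (A : set T) :
    (forall x y, A x -> A y -> (forall i, h i x <= h i y)%N -> x = y) ->
  finite_set A.
Proof.
move=> Aanti; apply: contrapT => /infiniteP/card_leP[f].
pose x (j : nat) : T := set_val (f (SigSub (mem_set (I : [set: nat] j)))).
have x_inj : injective x.
  move=> a b /val_inj ab.
  have := @inj _ _ _ f (SigSub (mem_set (I : [set: nat] a)))
    (SigSub (mem_set (I : [set: nat] b))).
  by rewrite !inE => /(_ I I ab) [].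
have Ax a : A (x a) by apply: set_valP.
have [g [g_lt g_le]] := dickson_subseq (enum J) (fun i j => h i (x j)).
suff /x_inj eq_g : x (g 0%N) = x (g 1%N) by have := g_lt 0%N 1%N isT; rewrite eq_g ltnn.
by apply: Aanti => // i; apply: (g_le i) => //; rewrite mem_enum.
Qed.

(** * Degrees, edges of the gcd-complex, and the linking relation *)

Section Degree.
Variables (n : nat) (L : zmodClosed 'rV[int]_n).
Local Notation M := 'X_{1..n}.
Implicit Types (u v w p q : M) (b : Quotient.quot L).

Lemma degA_expvec u : degA L u = \pi_(Quotient.quot L)%qT (expvec u).
Proof.
rewrite /degA.
have -> : expvec u = \sum_i delta_mx 0 i *+ u i.
  apply/rowP => j; rewrite summxE mxE (bigD1 j) //= mulmxnE !mxE !eqxx.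
  rewrite big1 ?addr0 ?natz // => i ij.
  by rewrite mulmxnE mxE eqxx eq_sym (negPf ij) mul0rn.
by rewrite raddf_sum; apply: eq_bigr => i _; rewrite raddfMn.
Qed.

Lemma degA_eq u v : degA L u = degA L v <-> expvec u - expvec v \in L.
Proof.
rewrite !degA_expvec Quotient.idealrBE.
by split=> [->|/eqP].
Qed.

Lemma degAD u v : degA L (u + v)%MM = degA L u + degA L v.
Proof.
by rewrite /degA -big_split; apply: eq_bigr => i _; rewrite mnmDE mulrnDr.
Qed.

Lemma degA_in u : monoidA L (degA L u).
Proof.
move=> B [[B0 BD] Bgen]; rewrite /degA.
elim/big_ind: _ => // i _; elim: (u i) => [//|m IH].
by rewrite mulrS; apply: BD => //; apply: Bgen; exists i.
Qed.

Lemma mgcd2E u v i : mgcd [fset u; v]%fset i = minn (u i) (v i).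
Proof.
rewrite mnmE; set m := (\max_(_ <- _) _)%N.
have le_m w : w \in [fset u; v]%fset -> (w i <= m)%N.
  by move=> wF; apply: (@leq_bigmax_seq _ _ _ (fun w : M => w i)).
have [um vm] := (le_m u (fset21 u v), le_m v (fset22 u v)).
(* The iterated minimum is identified through its lower bounds; the unit [m] then drops out because
   it bounds both exponents. *)
have le_min k (s : seq M) : (k <= \big[minn/m]_(w <- s) w i)%N =
    (k <= m)%N && all (fun w : M => (k <= w i)%N) s.
  elim: s => [|w s IH]; first by rewrite big_nil andbT.
  by rewrite big_cons leq_min IH /= andbCA.
suff eq_le k : (k <= \big[minn/m]_(w <- [fset u; v]%fset) w i)%N =
    (k <= minn (u i) (v i))%N.
  by apply/eqP; rewrite eqn_leq -eq_le leqnn eq_le leqnn.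
rewrite le_min leq_min; apply/andP/andP => [[_ /allP kF]|[ku kv]].
  by split; apply: kF; rewrite in_fset2 eqxx ?orbT.
split; first exact: leq_trans ku um.
by apply/allP => w; rewrite in_fset2 => /orP[]/eqP->.
Qed.

Lemma gcd_edgeP b u v : gcd_complex b [fset u; v]%fset <->
  [/\ degA L u = b, degA L v = b & exists i, (0 < u i)%N /\ (0 < v i)%N].
Proof.
split=> [[e0|[_ uvb gcd0]]|[ub vb [i [ui vi]]]].
- by have := fset21 u v; rewrite e0.
- split; [by apply: uvb; exact: fset21|by apply: uvb; exact: fset22|].
  apply: contrapT => noi; move/negP: gcd0; apply; apply/eqP/mnmP => i.
  rewrite mgcd2E mnm0E; apply/eqP; rewrite -leqn0 leqNgt; apply/negP.
  by rewrite leq_min => /andP[ui vi]; apply: noi; exists i.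
- right; split.
  + by apply/fset0Pn; exists u; exact: fset21.
  + by move=> w /=; rewrite in_fset2 => /orP[]/eqP->.
  + apply/eqP => /mnmP/(_ i); rewrite mgcd2E mnm0E => /eqP.
    by apply/negP; rewrite -lt0n leq_min ui.
Qed.

(** Taking the degree from [u] makes this a single equivalence relation on all monomials instead of
    one per degree. *)
Definition linked u : set M :=
  [set v | degA L u = degA L v /\ connected_in (gcd_complex (degA L u)) u v].

Lemma linked_deg u v : linked u v -> degA L u = degA L v.
Proof. by case. Qed.

Lemma linked_refl u : linked u u.
Proof. by split=> //; apply: rt_refl. Qed.

Lemma linked_trans u v w : linked u v -> linked v w -> linked u w.
Proof.
move=> [uv cuv] [vw]; rewrite -uv => cvw; split; first by rewrite uv.
exact: rt_trans cuv cvw.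
Qed.

Lemma linked_sym u v : linked u v -> linked v u.
Proof.
move=> [uv cuv]; split=> //; rewrite -uv.
move: (degA L u) cuv => b; rewrite /connected_in; elim=> [p q pq|p|p q r _ pq _ qr].
- by apply: rt_step; rewrite fsetUC.
- exact: rt_refl.
- exact: rt_trans qr pq.
Qed.

Lemma linked_edge i u v : degA L u = degA L v ->
  (0 < u i)%N -> (0 < v i)%N -> linked u v.
Proof. by move=> uv ui vi; split=> //; apply/rt_step/gcd_edgeP; split=> //; exists i. Qed.

(** Any variable dividing [x^m] divides both products, which therefore form an edge. *)
Lemma linkedD m u v : m != 0%MM -> degA L u = degA L v ->
  linked (m + u)%MM (m + v)%MM.
Proof.
rewrite -mdeg_eq0 mdegE -lt0n => m0 uv.
have [i mi] : exists i, (0 < m i)%N.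
  apply: contrapT => noi; move: m0; rewrite big1 // => i _; apply/eqP.
  by rewrite -leqn0 leqNgt; apply/negP => mi; apply: noi; exists i.
by apply: (@linked_edge i); rewrite ?degAD ?uv // mnmDE addn_gt0 mi.
Qed.

(** The ends of an edge share a variable, which can be factored out of both; a path is then handled
    by reflexivity and transitivity. *)
Lemma linked_ind (P : M -> M -> Prop) :
  (forall u, P u u) -> (forall u v w, P u v -> P v w -> P u w) ->
  (forall i u v, degA L (U_(i) + u)%MM = degA L (U_(i) + v)%MM ->
    P (U_(i) + u)%MM (U_(i) + v)%MM) ->
  forall u v, linked u v -> P u v.
Proof.
move=> Prefl Ptrans Pedge u v [_]; rewrite /connected_in.
elim=> [p q /gcd_edgeP[pb qb [i [pi qi]]]|//|p q r _ pq _ qr]; last exact: Ptrans qr.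
have sub (w : M) : (0 < w i)%N -> w = (U_(i) + (w - U_(i)))%MM.
  move=> wi; rewrite addmC submK //; apply/mnm_lepP => j.
  by rewrite mnm1E; case: eqP => // <-.
by rewrite (sub p) // (sub q) //; apply: Pedge; rewrite -!sub // pb qb.
Qed.

Lemma linked_eq u v : linked u v -> linked u = linked v.
Proof.
move=> uv; apply/seteqP; split=> w; first exact/linked_trans/linked_sym.
exact: linked_trans.
Qed.

Lemma componentsE b : components b = [set linked u | u in fiber b].
Proof.
apply/seteqP; split=> _ [u /= ub <-]; exists u => //; apply/seteqP; split=> v;
  rewrite /linked /= ub; by [case=> <-|case=> ->|].
Qed.

End Degree.

(** * Finiteness results from [L] meeting the nonnegative orthant only in 0 *)

Section Pointed.
Variables (n : nat) (L : zmodClosed 'rV[int]_n).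
Hypothesis hL : [set` L] `&` [set v : 'rV[int]_n | forall i, 0 <= v 0 i] = [set 0].
Local Notation M := 'X_{1..n}.
Implicit Types (u v w p q : M) (b : Quotient.quot L).

Lemma degA_le_eq u v : (u <= v)%MM -> degA L u = degA L v -> u = v.
Proof.
move=> /mnm_lepP uv /esym/degA_eq vuL.
have : ([set` L] `&` [set v : 'rV[int]_n | forall i, 0 <= v 0 i]) (expvec v - expvec u).
  by split=> // i; rewrite !mxE subr_ge0 lez_nat.
rewrite hL => /rowP vu0; apply/mnmP => i; apply/esym/eqP.
by have /eqP := vu0 i; rewrite !mxE subr_eq0.
Qed.

(** By [degA_le_eq] a fiber is an antichain for divisibility. *)
Lemma finite_fiber b : finite_set (fiber b).
Proof.
apply: (@dickson 'I_n _ (fun i u => u i)) => u v /= ub vb uv.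
by apply: degA_le_eq; [apply/mnm_lepP|rewrite ub vb].
Qed.

Lemma finite_linked u : finite_set (linked L u).
Proof. by apply: sub_finite_set (finite_fiber (degA L u)) => v /linked_deg. Qed.

(* Minimality of separated pairs: if [(u', v') <= (u, v)] are both separated
   and [u = w + u'], [v = z + v'] with [w, z != 0], then the path
   [w + u', w + v', z + v'] links [u] to [v]. *)
Lemma finite_separated :
  finite_set [set uv : M * M | degA L uv.1 = degA L uv.2 /\ ~ linked L uv.1 uv.2].
Proof.
apply: (@dickson (bool * 'I_n)%type (M * M)%type
  (fun c (uv : M * M) => if c.1 then uv.1 c.2 else uv.2 c.2)).
move=> [u' v'] [u v] /= [uv' nuv'] [uv nuv] le.
have /submK u'u : (u' <= u)%MM by apply/mnm_lepP => i; exact: (le (true, i)).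
have /submK v'v : (v' <= v)%MM by apply/mnm_lepP => i; exact: (le (false, i)).
move: u'u v'v; set w := (u - u')%MM; set z := (v - v')%MM => u'u v'v.
rewrite -u'u -v'v !degAD in uv nuv *; have := uv; rewrite uv' => /addIr wz.
have w_eq0 (m : M) : degA L m = degA L 0%MM -> m = 0%MM.
  move=> m0; apply/esym/degA_le_eq => //.
  by apply/mnm_lepP => i; rewrite mnm0E.
have [w0|w0] := eqVneq w 0%MM.
  by rewrite w0 (w_eq0 z) ?add0m // -wz w0.
(* The second link of the path uses the common factor [x^v'], so [v' = 0] has to be excluded: it
   would force [u' = 0] as well, and the pair would be linked. *)
have [v0|v0] := eqVneq v' 0%MM.
  by case: nuv'; rewrite (w_eq0 u') ?uv' ?v0 //; exact: linked_refl.
case: nuv; apply: linked_trans (linkedD w0 uv') _.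
by rewrite ![(_ + v')%MM]addmC; exact: linkedD.
Qed.

(** The measure for inductions on degrees: by [height_addl], multiplying by a nontrivial monomial
    raises it strictly. *)
Definition height b := (\max_(u <- fset_set (fiber b)) mdeg u)%N.

Lemma height_addl u w : (height (degA L u) + mdeg w <= height (degA L (u + w)%MM))%N.
Proof.
have in_fib b v : (v \in fset_set (fiber b)) = (degA L v == b).
  rewrite in_fset_set; last exact: finite_fiber.
  by apply/idP/eqP => [/set_mem|/mem_set].
have le_height v : degA L v = degA L u -> (mdeg w + mdeg v <= height (degA L (u + w)%MM))%N.
  move=> vu; rewrite addnC -mdegD; apply: leq_bigmax_seq => //.
  by rewrite in_fib !degAD vu.
(* Natural subtraction truncates, so moving [mdeg w] across the inequality needs this bound. *)
have wle := leq_trans (leq_addr _ _) (le_height u erefl).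
rewrite addnC -leq_subRL //; apply/bigmax_leqP_seq => v; rewrite in_fib => /eqP vu _.
by rewrite leq_subRL // le_height.
Qed.

End Pointed.

(** * Generated ideals *)

Section Ideals.
Variable R : comNzRingType.
Implicit Types (S I : set R).

Lemma is_ideal_generated S : is_ideal (ideal_generated S).
Proof.
split=> [I [[]]//|f g If Ig I SI|r f If I SI]; have [[_ ID IM] _] := SI.
  by apply: ID; [exact: If|exact: Ig].
by apply: IM; exact: If.
Qed.

Lemma sub_ideal_generated S : S `<=` ideal_generated S.
Proof. by move=> f Sf I [_]; exact. Qed.

Lemma ideal_generated_sub S I : is_ideal I -> S `<=` I -> ideal_generated S `<=` I.
Proof. by move=> idI SI f; exact. Qed.

Lemma ideal_subr I f g : is_ideal I -> I f -> I g -> I (f - g).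
Proof. by move=> [_ ID IM] If Ig; rewrite -mulN1r; apply: ID => //; exact: IM. Qed.

End Ideals.

(** * Coefficient functionals and homogeneous polynomials *)

Section Binomials.
Variables (n : nat) (k : fieldType) (L : zmodClosed 'rV[int]_n).
Local Notation M := 'X_{1..n}.
Local Notation R := {mpoly k[n]}.
Implicit Types (u v w p q m : M) (f g r : R) (c : k) (s : seq M).

(* The elements all of whose multiples are sent into [J] form an ideal, so only
   monomial multiples of the generators have to be examined. *)
Lemma ideal_generated_additive (W : zmodType) (phi : {additive R -> W})
    (J : set W) (S : set R) :
  J 0 -> (forall a b, J a -> J b -> J (a + b)) ->
  (forall c m f, S f -> J (phi (c *: 'X_[m] * f))) ->
  forall f, ideal_generated S f -> J (phi f).
Proof.
move=> J0 JD JS f /(_ [set f | forall r, J (phi (r * f))]); rewrite -[f in phi f]mul1r.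
apply; split=> [|g Sg r]; last first.
  rewrite (mpolyE r) mulr_suml raddf_sum.
  by elim/big_ind: _ => // m _; exact: JS.
split=> [r|g h Jg Jh r|r' g Jg r]; first by rewrite mulr0 raddf0.
  by rewrite mulrDr raddfD; apply: JD.
by rewrite mulrA.
Qed.

(** Used with [s] a fiber to detect degrees, and with [s] a component to detect a missing
    generator. *)
Definition coef_sum s f : k := \sum_(p <- s) f@_p.

Lemma coef_sum_is_zmod_morphism s : zmod_morphism (coef_sum s).
Proof.
by move=> f g; rewrite /coef_sum -sumrB; apply: eq_bigr => p _; rewrite mcoeffB.
Qed.

HB.instance Definition _ s :=
  GRing.isZmodMorphism.Build R k (coef_sum s) (coef_sum_is_zmod_morphism s).

Lemma coef_sumZ s c f : coef_sum s (c *: f) = c * coef_sum s f.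
Proof. by rewrite /coef_sum mulr_sumr; apply: eq_bigr => p _; rewrite mcoeffZ. Qed.

Lemma coef_sumX s p : uniq s -> coef_sum s 'X_[p] = (p \in s)%:R.
Proof.
move=> s_uniq; rewrite /coef_sum; have [ps|ps] := boolP (p \in s).
  rewrite (bigD1_seq p) //= mcoeffX eqxx big1 ?addr0 // => q qp.
  by rewrite mcoeffX eq_sym (negPf qp).
rewrite big_seq big1 // => q qs; rewrite mcoeffX.
by case: eqP => // pq; rewrite pq qs in ps.
Qed.

(** When [s] is the fiber of [b], this is the homogeneous component of degree [b]. *)
Definition proj s f : R := \sum_(p <- s) f@_p *: 'X_[p].

Lemma proj_is_zmod_morphism s : zmod_morphism (proj s).
Proof.
move=> f g; rewrite /proj -sumrB; apply: eq_bigr => p _.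
by rewrite mcoeffB scalerBl.
Qed.

HB.instance Definition _ s :=
  GRing.isZmodMorphism.Build R R (proj s) (proj_is_zmod_morphism s).

Lemma mcoeff_proj s f p : uniq s -> (proj s f)@_p = if p \in s then f@_p else 0.
Proof.
move=> s_uniq; rewrite /proj raddf_sum /=.
case: ifPn => ps.
  rewrite (bigD1_seq p) //= mcoeffZ mcoeffX eqxx mulr1 big1 ?addr0 // => q qp.
  by rewrite mcoeffZ mcoeffX (negPf qp) mulr0.
rewrite big_seq big1 // => q qs; rewrite mcoeffZ mcoeffX.
by case: eqP => [pq|]; rewrite ?mulr0 //; move: ps; rewrite -pq qs.
Qed.

Definition has_deg (b : Quotient.quot L) f :=
  forall u, u \in msupp f -> degA L u = b.

Lemma has_degX c u : has_deg (degA L u) (c *: 'X_[u]).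
Proof. by move=> v /msuppZ_le; rewrite msuppX inE => /eqP->. Qed.

Lemma has_degM a b f g : has_deg a f -> has_deg b g -> has_deg (a + b) (f * g).
Proof.
move=> fa gb u /msuppM_le/allpairsP[[v w] /= [vf wg ->]].
by rewrite degAD (fa v) ?(gb w).
Qed.

Lemma has_degB b f g : has_deg b f -> has_deg b g -> has_deg b (f - g).
Proof.
by move=> fb gb u /msuppB_le; rewrite mem_cat => /orP[/fb|/gb].
Qed.

Lemma has_degZ b c f : has_deg b f -> has_deg b (c *: f).
Proof. by move=> fb u /msuppZ_le/fb. Qed.

Lemma has_deg_binomial c u v :
  degA L u = degA L v -> has_deg (degA L u) (c *: ('X_[u] - 'X_[v])).
Proof.
move=> uv; apply/has_degZ/has_degB; first by rewrite -['X_[u]]scale1r; apply: has_degX.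
by rewrite uv -['X_[v]]scale1r; apply: has_degX.
Qed.

Lemma homogeneousA_binomial c u v :
  degA L u = degA L v -> homogeneousA L (c *: ('X_[u] - 'X_[v])).
Proof. by move=> uv; exists (degA L u); [exact: degA_in|exact: has_deg_binomial]. Qed.

Lemma lattice_idealX u v : degA L u = degA L v -> lattice_ideal L ('X_[k, u] - 'X_[v]).
Proof. by move=> /degA_eq uv; apply: sub_ideal_generated; exists u, v. Qed.

Lemma lattice_ideal_ideal : is_ideal (lattice_ideal (k := k) L).
Proof. exact: is_ideal_generated. Qed.

(** * Characterization of the minimal binomials *)

Section Pointed.
Hypothesis hL : [set` L] `&` [set v : 'rV[int]_n | forall i, 0 <= v 0 i] = [set 0].

Lemma in_fiber_fset (b : Quotient.quot L) u : (u \in fset_set (fiber b)) = (degA L u == b).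
Proof.
rewrite in_fset_set; last exact: finite_fiber.
by apply/idP/eqP => [/set_mem|/mem_set].
Qed.

(** Summing coefficients over the fiber of [u] kills the ideal, since both terms of a multiple of a
    generator have the same degree; were the degrees of [u] and [v] different, the sum would be
    1. *)
Lemma lattice_ideal_deg u v : lattice_ideal L ('X_[k, u] - 'X_[v]) -> degA L u = degA L v.
Proof.
move=> uvI; pose s := enum_fset (fset_set (fiber (degA L u))).
have s_uniq : uniq s by exact: fset_uniq.
have : coef_sum s ('X_[u] - 'X_[v]) = 0.
  move: uvI; apply: (@ideal_generated_additive k (coef_sum s) [set 0]) => //.
    by move=> a b /= -> ->; rewrite addr0.
  move=> c m _ [p [q [/degA_eq pq ->]]] /=.
  rewrite -scalerAl mulrBr -!mpolyXD coef_sumZ raddfB /= !coef_sumX //.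
  by rewrite !in_fiber_fset !degAD pq subrr mulr0.
rewrite raddfB /= !coef_sumX // !in_fiber_fset eqxx eq_sym.
by case: eqP => // _ /eqP; rewrite subr0 oner_eq0.
Qed.

Lemma proj_has_deg b f : has_deg b f -> proj (fset_set (fiber b)) f = f.
Proof.
move=> fb; apply/mpolyP => u; rewrite mcoeff_proj ?fset_uniq // in_fiber_fset.
case: eqP => // ub; apply/esym/eqP; rewrite mcoeff_eq0.
by apply/negP => /fb.
Qed.

Lemma proj_has_deg_neq a b f : has_deg b f -> a <> b -> proj (fset_set (fiber a)) f = 0.
Proof.
move=> fb ab; apply/mpolyP => u; rewrite mcoeff_proj ?fset_uniq // in_fiber_fset mcoeff0.
case: eqP => // ua; apply/eqP; rewrite mcoeff_eq0.
by apply/negP => /fb; rewrite ua.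
Qed.

(** Along an edge a variable factors out, leaving a difference of smaller height, which lies in [J];
    the differences along a path telescope. *)
Lemma linked_ideal (J : set R) (b : Quotient.quot L) : is_ideal J ->
  (forall p q, degA L p = degA L q -> (height (degA L p) < height b)%N ->
    J ('X_[p] - 'X_[q])) ->
  forall p q, linked L p q -> degA L p = b -> J ('X_[p] - 'X_[q]).
Proof.
move=> [J0 JD JM] Jlt p q pq pb.
(* The degree of [q] joins the conclusion because the transitivity case needs it to start the second
   half of the path. *)
suff: degA L p = b -> degA L q = b /\ J ('X_[p] - 'X_[q]) by case/(_ pb).
move: p q {pb} pq; apply: linked_ind => [p pb|p q r pq qr /pq [qb Jpq]|i p q pq pb].
- by rewrite subrr.
- have [rb Jqr] := qr qb; split=> //.
  by rewrite -(subrKA 'X_[q]); exact: JD.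
- rewrite -pq pb; split=> //; rewrite !mpolyXD -mulrBr; apply/JM/Jlt.
    by move: pq; rewrite !degAD => /addrI.
  have := height_addl hL p U_(i); rewrite mdeg1 addn1 addmC pb.
  exact.
Qed.

(* A generator [f] of degree [b] does not contribute to the degrees whose
   height is less than that of [b]. *)
Lemma minimal_binomial_not_linked (S : set R) c u v :
  minimal_generating_set L S -> S (c *: ('X_[u] - 'X_[v])) ->
  degA L u = degA L v -> ~ linked L u v.
Proof.
set f := (c *: _) => -[[Shom SI] Smin] Sf uv luv.
pose b := degA L u; pose J := ideal_generated (S `\ f).
have idJ : is_ideal J by exact: is_ideal_generated.
have [J0 JD JM] := idJ.
have projJ (a : Quotient.quot L) g : (height a < height b)%N -> lattice_ideal L g ->
    J (proj (fset_set (fiber a)) g).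
  move=> ab; rewrite -SI.
  apply: (@ideal_generated_additive R (proj (fset_set (fiber a))) J) => // d m h Sh /=.
  have [->|hf] := eqVneq h f.
    have mh := has_degM (has_degX (c := d) (u := m)) (has_deg_binomial (c := c) uv).
    rewrite (proj_has_deg_neq mh) // => am.
    move: ab; rewrite am addrC -degAD ltnNge => /negP; apply.
    exact: leq_trans (leq_addr _ _) (height_addl hL u m).
  have [e _ he] := Shom h Sh.
  have mh := has_degM (has_degX (c := d) (u := m)) he.
  have [->|ae] := eqVneq a (degA L m + e); last by rewrite (proj_has_deg_neq mh) //; exact/eqP.
  rewrite (proj_has_deg mh).
  by apply: JM; apply: sub_ideal_generated; split=> //; exact/eqP.
have Jf : J f.
  rewrite /f -mul_mpolyC; apply: JM; apply: linked_ideal luv erefl => // p q pq ltb.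
  (* A homogeneous difference is its own projection to its degree, which brings [projJ] into
     play. *)
  have := has_deg_binomial (c := 1) pq; rewrite scale1r => /proj_has_deg <-.
  by apply: projJ => //; exact: lattice_idealX.
have : S `\ f = S.
  apply: Smin; first by move=> h [].
  split; first by move=> h [/Shom].
  rewrite -SI; apply/seteqP; split.
    apply: ideal_generated_sub; first exact: is_ideal_generated.
    by move=> h [Sh _]; exact: sub_ideal_generated.
  apply: ideal_generated_sub => // h Sh.
  have [->//|hf] := eqVneq h f.
  by apply: sub_ideal_generated; split=> //; exact/eqP.
by move=> SE; move: Sf; rewrite -SE => -[_]; exact.
Qed.

(* If an element [c (x^base - x^(rep w))] is left out, then summing coefficients
   over the component of [w] kills the ideal generated by the others: multiplying
   by a nontrivial monomial moves both terms into the same component. *)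
Lemma binomial_generating_set_minimal (rep base : M -> M) c :
  c != 0 ->
  (forall w, linked L w (rep w)) ->
  (forall w w', linked L w w' -> rep w = rep w') ->
  (forall w, degA L (base w) = degA L w) ->
  (forall w w', degA L w = degA L w' -> base w = base w') ->
  (forall w, rep (base w) = base w) ->
  minimal_generating_set L
    [set f | exists2 w, base w != rep w & f = c *: ('X_[k, base w] - 'X_[rep w])].
Proof.
move=> c0 rep_linked rep_eq base_deg base_eq rep_base; set S := [set f | _].
have deg_rep w : degA L (base w) = degA L (rep w).
  by rewrite base_deg; exact: linked_deg.
have Shom : S `<=` homogeneousA L.
  by move=> _ [w _ ->]; exact: homogeneousA_binomial.
have idI := lattice_ideal_ideal; have [I0 ID IM] := idI.
have idJ := is_ideal_generated S; have [J0 JD JM] := idJ.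
have JB := ideal_subr idJ.
have SI : S `<=` lattice_ideal L.
  by move=> _ [w _ ->]; rewrite -mul_mpolyC; apply: IM; exact: lattice_idealX.
have JS w : ideal_generated S ('X_[base w] - 'X_[rep w]).
  have [->|brw] := eqVneq (base w) (rep w); first by rewrite subrr.
  rewrite -[X in ideal_generated _ X]scale1r -(mulVf c0) -scalerA -mul_mpolyC.
  by apply: JM; apply: sub_ideal_generated; exists w.
(* Strong induction on the height: the smaller heights settle the linked pairs of the current degree
   through [linked_ideal]. *)
have Jbin p q : degA L p = degA L q -> ideal_generated S ('X_[p] - 'X_[q]).
  have [h] := ubnP (height (degA L p)); elim: h p q => // h IH p q /ltnSE ph pq.
  have Jlink p' q' : linked L p' q' -> degA L p' = degA L p ->
      ideal_generated S ('X_[p'] - 'X_[q']).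
    apply: linked_ideal => // p1 q1 pq1 lt1; apply: IH => //.
    exact: leq_trans lt1 ph.
  (* From [p] go to its representative, then to the base shared with [q], then to the representative
     of [q], and finally to [q]. *)
  have -> : 'X_[p] - 'X_[q] = ('X_[p] - 'X_[rep p]) - ('X_[base p] - 'X_[rep p])
      - ('X_[q] - 'X_[rep q]) + ('X_[base q] - 'X_[rep q]) :> R.
    by rewrite (base_eq p q pq); ring.
  by apply: JD => //; apply: (JB); [apply: (JB)|]; rewrite ?JS //; exact: Jlink.
have Sgen : homogeneous_generating_set L S.
  split=> //; apply/seteqP; split; first exact: ideal_generated_sub.
  apply: ideal_generated_sub => // _ [p [q [/degA_eq pq ->]]].
  exact: Jbin.
split=> // S' S'S [_ S'I]; apply/seteqP; split=> // s Ss; have [w brw s_def] := Ss.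
apply: contrapT => nS's.
pose K := fset_set (linked L w).
have inK p : (p \in K) = `[< linked L w p >].
  rewrite in_fset_set; last exact: finite_linked.
  by apply/idP/asboolP => [/set_mem|/mem_set].
have K_uniq : uniq K by exact: fset_uniq.
(* A base linked to [w] would be the base of the fiber of [w] and also its own representative,
   making [base w] equal to [rep w]. *)
have base_linked w1 : `[< linked L w (base w1) >] = false.
  apply/asboolP => lw; case/eqP: brw.
  rewrite (rep_eq _ _ lw) rep_base; apply: base_eq.
  by rewrite (linked_deg lw) base_deg.
have phi_eq0 : coef_sum K s = 0.
  have : ideal_generated S' s by rewrite S'I; exact: SI.
  apply: (@ideal_generated_additive k (coef_sum K) [set 0]) => //.
    by move=> a b /= -> ->; rewrite addr0.
  move=> d m g S'g /=; have [w' brw' g_def] := S'S _ S'g.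
  rewrite g_def -scalerAl -scalerAr mulrBr -!mpolyXD !coef_sumZ raddfB /= !coef_sumX // !inK.
  have [->|m0] := eqVneq m 0%MM; last first.
    suff -> : `[< linked L w (m + base w')%MM >] = `[< linked L w (m + rep w')%MM >].
      by rewrite subrr !mulr0.
    have ml := linkedD m0 (deg_rep w'); apply/asboolP/asboolP => lw.
      exact: linked_trans ml.
    exact: linked_trans (linked_sym ml).
  (* With a trivial multiplier only [rep w'] could lie in the component of [w], but then [g] would
     be the omitted element [s]. *)
  rewrite !add0m base_linked.
  have -> : `[< linked L w (rep w') >] = false; last by rewrite subrr !mulr0.
  apply/asboolP => lw; apply: nS's; rewrite s_def.
  have lww' : linked L w w' := linked_trans lw (linked_sym (rep_linked w')).
  by rewrite (rep_eq _ _ lww') (base_eq _ _ (linked_deg lww')) -g_def.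
move: phi_eq0; rewrite s_def coef_sumZ raddfB /= !coef_sumX // !inK base_linked.
have -> : `[< linked L w (rep w) >] by apply/asboolP.
by rewrite sub0r mulrN1 => /eqP; rewrite oppr_eq0 (negPf c0).
Qed.

(** The system of representatives is chosen with [u] as base of its fiber and [v] as representative
    of its own component, so the given binomial is one of the generators. *)
Lemma separated_binomial_minimal c u v :
  c != 0 -> degA L u = degA L v -> ~ linked L u v ->
  exists2 S, minimal_generating_set L S & S (c *: ('X_[k, u] - 'X_[v])).
Proof.
move=> c0 uv nuv.
(* Linked monomials have equal sets [linked L w], so every test and choice here depends only on the
   component; likewise [base] depends only on the degree. *)
pose rep w := if `[< linked L w u >] then u else if `[< linked L w v >] then v
  else xget 0%MM (linked L w).
pose base w := if degA L w == degA L u then u else rep (xget 0%MM (fiber (degA L w))).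
have rep_linked w : linked L w (rep w).
  rewrite /rep; case: asboolP => // _; case: asboolP => // _.
  by apply: xgetPex; exists w; exact: linked_refl.
have rep_eq w w' : linked L w w' -> rep w = rep w'.
  by move=> /linked_eq ww'; rewrite /rep ww'.
have base_deg w : degA L (base w) = degA L w.
  rewrite /base; case: eqP => [->//|_]; rewrite -(linked_deg (rep_linked _)).
  by apply: (@xgetPex _ 0%MM (fiber (degA L w))); exists w.
have base_eq w w' : degA L w = degA L w' -> base w = base w'.
  by rewrite /base => ->.
have rep_base w : rep (base w) = base w.
  rewrite /base; case: eqP => [_|_]; last exact/esym/rep_eq/rep_linked.
  by rewrite /rep; case: asboolP => // -[]; exact: linked_refl.
eexists.
  exact: (binomial_generating_set_minimal c0 rep_linked rep_eq base_deg base_eq rep_base).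
have base_v : base v = u by rewrite /base uv eqxx.
have rep_v : rep v = v.
  rewrite /rep; case: asboolP => [/linked_sym//|_].
  by case: asboolP => // -[]; exact: linked_refl.
exists v; rewrite base_v rep_v //.
by apply: contra_notN nuv => /eqP->; exact: linked_refl.
Qed.

Lemma minimal_binomialP f : minimal_binomial L f <-> exists c u v,
  [/\ c != 0, degA L u = degA L v, ~ linked L u v & f = c *: ('X_[u] - 'X_[v])].
Proof.
split=> [[[c [u [v [c0 uv /lattice_ideal_deg duv ->]]]] [S Smin Sf]]|[c [u [v [c0 uv nuv ->]]]]].
  by exists c, u, v; split=> //; exact: minimal_binomial_not_linked Sf duv.
split; last exact: separated_binomial_minimal.
exists c, u, v; split=> //; last exact: lattice_idealX.
by apply: contra_notN nuv => /eqP->; exact: linked_refl.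
Qed.

End Pointed.
End Binomials.

(** * Counting the classes by oriented pairs of monomials *)

Section Count.
Variables (n : nat) (k : fieldType) (L : zmodClosed 'rV[int]_n).
Hypothesis hL : [set` L] `&` [set v : 'rV[int]_n | forall i, 0 <= v 0 i] = [set 0].
Local Notation M := 'X_{1..n}.
Implicit Types (u v w p q : M) (b : Quotient.quot L).

(** The index of the component of [u] in the very enumeration that [component_pairs] sums over. *)
Definition component_rank u : nat :=
  index (linked L u) (enum_fset (fset_set (components (degA L u)))).

Lemma mem_components b (K : set M) :
  (K \in enum_fset (fset_set (components b))) =
    `[< exists2 u, degA L u = b & linked L u = K >].
Proof.
rewrite in_fset_set; last by rewrite componentsE; exact/finite_image/finite_fiber.
by rewrite componentsE; apply/idP/asboolP => [/set_mem//|]; rewrite inE.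
Qed.

Lemma component_rank_inj u v : degA L u = degA L v ->
  component_rank u = component_rank v -> linked L u v.
Proof.
rewrite /component_rank => uv; rewrite uv => /index_inj.
rewrite !mem_components => /(_ (linked L u)) E.
suff -> : linked L u = linked L v by exact: linked_refl.
by apply: E => //; apply/asboolP; [exists u|exists v].
Qed.

Lemma linked_component_rank u v : linked L u v -> component_rank u = component_rank v.
Proof.
by move=> uv; rewrite /component_rank (linked_eq uv) (linked_deg uv).
Qed.

(** Each unordered pair of unlinked monomials of equal degree occurs in exactly one of its two
    orders, matching the condition [i < j]. *)
Definition oriented_pairs : set (M * M) :=
  [set uv | degA L uv.1 = degA L uv.2 /\
            (component_rank uv.1 < component_rank uv.2)%N].

Lemma finite_oriented_pairs : finite_set oriented_pairs.
Proof.
apply: sub_finite_set (finite_separated hL) => -[u v] /= [uv lt_uv]; split=> //.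
by move=> /linked_component_rank E; rewrite E ltnn in lt_uv.
Qed.

Lemma component_rank_lt b u : degA L u = b ->
  (component_rank u < size (enum_fset (fset_set (components b))))%N.
Proof.
by move=> <-; rewrite index_mem mem_components; apply/asboolP; exists u.
Qed.

Lemma nvertices_component b i :
  let K := enum_fset (fset_set (components b)) in
  (i < size K)%N ->
  nvertices (nth set0 K i) =
    count (fun u => component_rank u == i) (fset_set (fiber b)).
Proof.
move=> K iK; rewrite -size_filter; apply/perm_size/uniq_perm.
- exact: fset_uniq.
- by rewrite filter_uniq ?fset_uniq.
have : nth set0 K i \in K by exact: mem_nth.
rewrite mem_components => /asboolP[v vb vK] u.
rewrite -vK; have -> : i = component_rank v.
  by rewrite /component_rank vK vb index_uniq // fset_uniq.
rewrite mem_filter in_fiber_fset // in_fset_set; last exact: finite_linked.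
apply/idP/andP => [/set_mem vu|[/eqP uv /eqP ub]].
  by rewrite (linked_component_rank vu) eqxx -(linked_deg vu) vb.
by apply/mem_set/linked_sym/component_rank_inj => //; rewrite ub.
Qed.

Lemma count_sum (T : Type) (a : pred T) (s : seq T) :
  count a s = (\sum_(x <- s) a x)%N.
Proof. by elim: s => [|x s IH]; rewrite ?big_nil ?big_cons //= IH. Qed.

Lemma sum_ord_pair_eq N i0 j0 : (i0 < N)%N -> (j0 < N)%N ->
  (\sum_(i < N) \sum_(j < N | i < j) (i0 == i) * (j0 == j))%N = (i0 < j0)%N.
Proof.
move=> i0N j0N; rewrite (bigD1 (Ordinal i0N)) //= [X in (_ + X)%N]big1 ?addn0.
  rewrite eqxx big_mkcond (bigD1 (Ordinal j0N)) //= [X in (_ + X)%N]big1 ?addn0.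
    by rewrite eqxx; case: ltnP.
  by move=> j jj0; rewrite eq_sym (negPf jj0 : (nat_of_ord j == j0) = false) if_same.
move=> i ii0; rewrite big1 // => j _.
by rewrite eq_sym (negPf ii0 : (nat_of_ord i == i0) = false).
Qed.

(** Double counting: a product of two component sizes counts the pairs of monomials with the two
    given ranks. After exchanging the sums, a pair contributes 1 exactly when its ranks increase. *)
Lemma component_pairsE b :
  component_pairs b = count (fun uv => degA L uv.1 == b) (fset_set oriented_pairs).
Proof.
rewrite /component_pairs; set K := enum_fset _; set F := enum_fset (fset_set (fiber b)).
pose FF := [seq (u, v) | u <- F, v <- F].
have -> : count (fun uv => degA L uv.1 == b) (fset_set oriented_pairs) =
    count (fun uv => (component_rank uv.1 < component_rank uv.2)%N) FF.
  rewrite -!size_filter; apply/perm_size/uniq_perm.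
  - by rewrite filter_uniq ?fset_uniq.
  - by rewrite filter_uniq // allpairs_uniq ?fset_uniq // => -[u v] [].
  move=> [u v]; rewrite !mem_filter in_fset_set; last exact: finite_oriented_pairs.
  have -> : ((u, v) \in FF) = (degA L u == b) && (degA L v == b).
    rewrite -!in_fiber_fset //; apply/allpairsP/andP => [[[u' v'] [? ? [-> ->]]]//|[uF vF]].
    by exists (u, v).
  apply/andP/and3P => [[/eqP ub /set_mem[/= uv lt_uv]]|[lt_uv /eqP ub /eqP vb]].
    by rewrite lt_uv -uv ub eqxx.
  by rewrite ub eqxx; split=> //; apply/mem_set; split; rewrite //= ub.
transitivity (\sum_(i < size K) \sum_(j < size K | (i < j)%N)
    \sum_(uv <- FF) (component_rank uv.1 == i) * (component_rank uv.2 == j))%N.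
  apply: eq_bigr => i _; apply: eq_bigr => j _.
  by rewrite !nvertices_component // !count_sum big_distrlr /= big_allpairs.
rewrite count_sum.
transitivity (\sum_(i < size K) \sum_(uv <- FF) \sum_(j < size K | (i < j)%N)
    (component_rank uv.1 == i) * (component_rank uv.2 == j))%N.
  by apply: eq_bigr => i _; rewrite exchange_big.
rewrite exchange_big /= [LHS]big_seq [RHS]big_seq; apply: eq_bigr => uv.
move=> /allpairsP[[u v] /= [uF vF ->]] /=.
rewrite !in_fiber_fset // in uF vF.
by rewrite sum_ord_pair_eq //; apply: component_rank_lt; exact/eqP.
Qed.

(** The sum is supported on the finite list [D] of degrees of oriented pairs, and each pair is
    counted at its one degree. *)
Lemma sum_component_pairs :
  \sum_(b \in monoidA L) component_pairs b = #|` fset_set oriented_pairs|.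
Proof.
set P := enum_fset _; pose D := undup [seq degA L uv.1 | uv <- P].
have degD uv : uv \in P -> degA L uv.1 \in D.
  by move=> uvP; rewrite mem_undup; apply/mapP; exists uv.
rewrite (@fsbigE _ _ _ _ _ D) ?undup_uniq //; last 2 first.
- by move=> b /=; rewrite mem_undup => /mapP[uv _ ->]; exact: degA_in.
- move=> b _ bD; rewrite component_pairsE; apply/eqP; rewrite eqn0Ngt -has_count.
  by apply: contra bD => /hasP[uv uvP /eqP <-]; exact: degD.
transitivity (\sum_(b <- D) \sum_(uv <- P) (degA L uv.1 == b))%N.
  rewrite [LHS]big_mkcond /= [LHS]big_seq [RHS]big_seq; apply: eq_bigr => b.
  rewrite mem_undup => /mapP[uv _ bE]; rewrite component_pairsE count_sum.
  by rewrite ifT // bE; apply/mem_set; exact: degA_in.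
rewrite exchange_big /= -sum1_size big_seq [RHS]big_seq; apply: eq_bigr => uv /degD uvD.
rewrite (bigD1_seq _ uvD) ?undup_uniq //= eqxx big1 // => b.
by rewrite eq_sym => /negPf->.
Qed.

Definition binomial_class (uv : M * M) : set {mpoly k[n]} :=
  [set g | scalar_equiv g ('X_[uv.1] - 'X_[uv.2])].

(** Proportional differences have the same two monomials, and the order of the ranks rules out the
    swap. *)
Lemma binomial_class_inj : {in oriented_pairs &, injective binomial_class}.
Proof.
move=> [u v] [u' v'] /set_mem[/= _ uv] /set_mem[/= _ uv'] eq_cl.
have : binomial_class (u', v') ('X_[u] - 'X_[v]).
  by rewrite -eq_cl; exists 1; rewrite ?oner_eq0 ?scale1r.
move=> [c c0 /= E].
have nuv : v != u by apply: contraTneq uv => ->; rewrite ltnn.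
(* Compare the coefficients of [w] in [E]: the left one is 1 or -1, so the right one cannot
   vanish. *)
have mem w : w = u \/ w = v -> w = u' \/ w = v'.
  move=> wuv; have [->|wu'] := eqVneq w u'; first by left.
  have [->|wv'] := eqVneq w v'; first by right.
  have := congr1 (mcoeff w) E; rewrite mcoeffZ !mcoeffB !mcoeffX.
  rewrite ![_ == w]eq_sym (negPf wu') (negPf wv') subrr mulr0.
  case: wuv => ->; rewrite eqxx.
    by rewrite eq_sym (negPf nuv) subr0 => /eqP; rewrite oner_eq0.
  by rewrite (negPf nuv) sub0r => /eqP; rewrite oppr_eq0 oner_eq0.
have [uE|uE] := mem u (or_introl erefl); have [vE|vE] := mem v (or_intror erefl).
- by rewrite uE vE eqxx in nuv.
- by rewrite uE vE.
- by rewrite uE vE ltnNge (ltnW uv') in uv.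
- by rewrite uE vE eqxx in nuv.
Qed.

(** Scaling does not change a class, so a pair with decreasing ranks may be swapped at the cost of a
    sign; equal ranks would make the pair linked. *)
Lemma minimal_binomial_classesE :
  minimal_binomial_classes k L = binomial_class @` oriented_pairs.
Proof.
have class_scale c (f : {mpoly k[n]}) : c != 0 ->
    [set g | scalar_equiv g (c *: f)] = [set g | scalar_equiv g f].
  move=> c0; apply/seteqP; split=> g [d d0 ->].
    by exists (d * c); rewrite ?mulf_neq0 // scalerA.
  by exists (d / c); rewrite ?mulf_neq0 ?invr_eq0 // scalerA divfK.
apply/seteqP; split=> [_ [_ /(minimal_binomialP hL)[c [u [v [c0 uv nuv ->]]]] <-]|].
  case: (ltngtP (component_rank u) (component_rank v)) => ltuv.
  - by exists (u, v) => //; rewrite class_scale.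
  - exists (v, u) => //.
    by rewrite class_scale // -opprB -scaleN1r class_scale // oppr_eq0 oner_eq0.
  - by case: nuv; exact: component_rank_inj.
move=> _ [[u v] [/= uv ltuv] <-].
exists ('X_[u] - 'X_[v]) => //; apply/(minimal_binomialP hL).
exists 1, u, v; split=> //; rewrite ?oner_eq0 ?scale1r //.
by move=> /linked_component_rank rE; rewrite rE ltnn in ltuv.
Qed.

End Count.

Theorem theorem3p5 (n : nat) (k : fieldType) (L : zmodClosed 'rV[int]_n)
  (hL : [set` L] `&` [set v : 'rV[int]_n | forall i, 0 <= v 0 i] = [set 0]) :
  finite_set [set b | monoidA L b /\ component_pairs b <> 0%N] /\
  (minimal_binomial_classes k L #=
    `I_(\sum_(b \in monoidA L) component_pairs b))%card.
Proof.
split.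
  (* Finite support makes the sum over [monoidA L] meaningful, as with infinite support it would
     default to 0. A nonzero term at [b] yields an oriented pair of degree [b]. *)
  apply: (@sub_finite_set _ _ ((fun uv => degA L uv.1) @` oriented_pairs L)); last first.
    exact/finite_image/finite_oriented_pairs.
  move=> b [_ /eqP]; rewrite component_pairsE // -lt0n -has_count => /hasP[uv uvP /eqP <-].
  exists uv => //; apply/set_mem; rewrite -in_fset_set //.
  exact: finite_oriented_pairs.
rewrite minimal_binomial_classesE // sum_component_pairs //.
apply: card_eq_trans (inj_card_eq (@binomial_class_inj _ k L)) _.
rewrite -[X in (X #= _)%card]fset_setK; last exact: finite_oriented_pairs.
exact/card_eq_fsetP.
Qed.
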